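(* Let $X$ be a compact metrizable space. If $X$ has a path-component which is not closed in $X$, then $X$ is not $e$-closed.
   Context: ''Space'' means compact metrizable space and ''map'' means continuous function. A space pair is a pair $(Y,Z)$ where $Y$ is a space and $Z\subseteq Y$ is a closed subspace. For spaces $X,Z$, $X^Z$ denotes the set of maps from $Z$ to $X$ with the topology of uniform convergence (equivalently, the compact-open topology). For a space pair $(Y,Z)$, $X^{Z\uparrow Y}\subseteq X^Z$ denotes the set of maps from $Z$ to $X$ which extend to a map from $Y$ to $X$. A space $X$ is $e$-closed if, for every space pair $(Y,Z)$, the set $X^{Z\uparrow Y}$ is closed in $X^Z$. *)

(* Defs.v *)
From HB Require Import structures.
From mathcomp Require Import all_boot all_order all_algebra.
From mathcomp Require Import all_classical all_reals topology.

Set Implicit Arguments.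
Unset Strict Implicit.
Unset Printing Implicit Defensive.

Import Order.TTheory GRing.Theory Num.Theory numFieldTopology.Exports.

Local Open Scope classical_set_scope.
Local Open Scope ring_scope.

Definition metrizable (R : realType) (T : topologicalType) : Prop :=
  exists d : T -> T -> R,
    [/\ forall x y, d x y = 0 <-> x = y,
        forall x y, d x y = d y x,
        forall x y z, d x z <= d x y + d y z
      & forall x, nbhs x = nbhs_ball_ (fun x e => [set y | d x y < e]) x].

Definition compact_metrizable (R : realType) (T : topologicalType) : Prop :=
  compact [set: T] /\ metrizable R T.

(* A path is a function on the whole line of which only the restriction to
   [0, 1] matters. *)
Definition path_component (R : realType) (X : topologicalType) (x : X) :
    set X :=
  [set y | exists f : R -> X,
    [/\ {within `[0, 1], continuous f}, f 0 = x & f 1 = y]].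

Section extendable.
(* Gives [continuousType Z X] the compact-open topology, which needs no choice
   of a metric on [X]; for compact [Z] and metrizable [X] it is the topology of
   uniform convergence. *)
Import ArrowAsCompactOpen.

Definition extendable (X Y : topologicalType) (Z : set Y) :
    set (continuousType Z X) :=
  [set f | exists g : continuousType Y X, forall z : Z, g (\val z) = f z].

(* [Y] may be empty, as may [Z]. *)
Definition e_closed (R : realType) (X : topologicalType) : Prop :=
  forall (Y : topologicalType) (Z : set Y),
    compact_metrizable R Y -> closed Z -> closed (@extendable X Y Z).

End extendable.

(* Main.v *)
Require Import Defs.
From mathcomp Require Import all_boot all_order all_algebra.
From mathcomp Require Import all_classical all_reals topology.
From mathcomp Require Import normedtype.

Import Order.TTheory GRing.Theory Num.Theory numFieldTopology.Exports.

Local Open Scope classical_set_scope.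
Local Open Scope ring_scope.

(** The interval [0, 1] with its pair of endpoints Z = {0, 1} tests whether path
components are closed. A map Z -> X sending 0 to x and 1 to p extends to [0, 1]
exactly when there is a path from x to p, that is, when p lies in the path
component of x ([path_componentE]). The map sending p to this two-point map,
[ends_at], is continuous from X to the function space ([ends_at_continuous]), so
the path component of x is the preimage of the set of extendable maps under a
continuous map. If X is e-closed, the latter set is closed for this space pair,
and therefore every path component of X is closed.

That this is a space pair, and that the two-point maps are
continuous and depend continuously on p, rests on [0, 1] being compact metrizable
as a subtype of the line and on the set of endpoints being closed and
discrete. *)

Lemma metrizable_realType (R : realType) : metrizable R R.
Proof.
exists (fun x y => `|x - y|); split.
- by move=> x y; split=> [/normr0_eq0/subr0_eq|->]; rewrite ?subrr ?normr0.
- by move=> x y; rewrite distrC.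
- by move=> x y z; exact: ler_distD.
- by move=> x; rewrite -nbhs_ballE.
Qed.

Lemma nbhs_subtype (T : topologicalType) (A : set T) (a : A) (U : set A) :
  nbhs a U <-> exists2 V, nbhs (\val a) V & \val @^-1` V `<=` U.
Proof.
split.
  case=> _ [[W oW <-] /= Wa WU]; exists W => //.
  exact: open_nbhs_nbhs.
case=> V Va VU; apply: filterS VU _.
exact: (@initial_continuous A T set_val a _ Va).
Qed.

Lemma metrizable_subtype (R : realType) (T : topologicalType) (A : set T) :
  metrizable R T -> metrizable R A.
Proof.
case=> d [d0 dC dD dN]; exists (fun a b : A => d (\val a) (\val b)); split.
- by move=> a b; rewrite d0; split=> [/val_inj|->].
- by move=> a b; exact: dC.
- by move=> a b c; exact: dD.
- move=> a; rewrite predeqE => U; rewrite nbhs_subtype dN; split.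
    case=> V [e e0 eV] VU; exists e => //.
    by move=> b /= ab; apply/VU/eV.
  case=> e e0 eU; exists [set y | d (\val a) y < e]; last exact: eU.
  by exists e.
Qed.

(** A filter on the subtype is pushed forward to the ambient space, where
compactness of the set provides a cluster point inside the set. *)
Lemma compact_subtype (T : topologicalType) (A : set T) :
  compact A -> compact [set: A].
Proof.
move=> cA F PF _.
have FA : (set_val @ F) A.
  by apply: nearW => a; exact: set_valP.
have [x [Ax clx]] := cA (set_val @ F) _ FA.
exists (SigSub (mem_set Ax)); split=> // B U FB /nbhs_subtype[V Vx VU].
have FB' : (set_val @ F) (set_val @` B).
  rewrite /fmap /=; apply: filterS FB => a Ba; exact: imageP.
have [_ [[b Bb <-] Vb]] := clx _ _ FB' Vx.
by exists b; split=> //; exact: VU.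
Qed.

Lemma clopen_if_continuous (S T : topologicalType) (D : set S) (f g : S -> T) :
  clopen D -> continuous f -> continuous g ->
  continuous (fun s => if s \in D then f s else g s).
Proof.
move=> [oD cD] cf cg s; have [sD|sD] := boolP (s \in D).
  rewrite /continuous_at sD; apply: (cvg_trans _ (cf s)); apply: near_eq_cvg.
  have := open_nbhs_nbhs (conj oD (set_mem sD)).
  by apply: filterS => t Dt /=; rewrite mem_set.
rewrite /continuous_at (negbTE sD).
apply: (cvg_trans _ (cg s)); apply: near_eq_cvg.
have Ds : (~` D) s by rewrite notin_setE in sD.
have := open_nbhs_nbhs (conj (closed_openC cD) Ds).
by apply: filterS => t Dt /=; rewrite memNset.
Qed.

Section EndpointPair.
Import ArrowAsCompactOpen.
Context {R : realType}.

Local Notation unit_interval := (set_type (`[0, 1]%classic : set R)).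

Definition endpoints : set unit_interval := \val @^-1` [set 0; 1].

Lemma compact_metrizable_unit_interval : compact_metrizable R unit_interval.
Proof.
split; first exact/compact_subtype/segment_compact.
exact/metrizable_subtype/metrizable_realType.
Qed.

Lemma closed_endpoints : closed endpoints.
Proof.
apply: preimage_closed => [y _|]; first exact: initial_continuous.
by apply: closedU; exact: closed_eq.
Qed.

Definition left_end : set endpoints := [set z | \val (\val z) = 0].

(** Among the endpoints, being 0 is the same as not being 1: both conditions are
closed, so each of them is also open. *)
Lemma clopen_left_end : clopen left_end.
Proof.
have clt t : closed [set z : endpoints | \val (\val z) = t].
  have /continuous_closedP cval :
      continuous (fun z : endpoints => \val (\val z)).
    move=> z; apply: (@continuous_comp endpoints unit_interval R).
      exact: (@initial_continuous _ _ (set_val : endpoints -> unit_interval)).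
    exact: (@initial_continuous _ _ (set_val : unit_interval -> R)).
  exact: (cval [set t] (@closed_eq _ t)).
split; last exact: clt.
have -> : left_end = ~` [set z | \val (\val z) = 1].
  rewrite predeqE => z; split=> [z0 z1|z1].
    by move/eqP: (oner_neq0 R); apply; rewrite -z1.
  by case: (set_valP z).
exact: closed_openC (clt 1).
Qed.

Context {X : topologicalType} (x : X).

(** The two-point map 0 |-> x, 1 |-> p, kept uncurried in (p, z): its joint
continuity yields by currying both the continuity of each two-point map and the
continuity of its dependence on p in the compact-open topology. *)
Definition endpoint_pair (pz : X * endpoints) : X :=
  if pz.2 \in left_end then x else pz.1.

Lemma endpoint_pair_continuous : continuous endpoint_pair.
Proof.
have cD : clopen (snd @^-1` left_end : set (X * endpoints)).
  by apply: preimage_clopen clopen_left_end _ => pz; exact: cvg_snd.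
apply: (clopen_if_continuous _ _ _ (cst x) fst cD).
- by move=> pz; exact: cvg_cst.
- by move=> pz; exact: cvg_fst.
Qed.

Lemma curry_endpoint_pair_continuous (p : X) : continuous (curry endpoint_pair p).
Proof.
by have [_] := continuous_curry endpoint_pair_continuous; exact.
Qed.

Definition ends_at (p : X) : continuousType endpoints X :=
  mkcts (curry_endpoint_pair_continuous p).

Lemma ends_at_continuous : continuous ends_at.
Proof.
apply: continuous_comp_initial.
exact: continuous_curry_fun endpoint_pair_continuous.
Qed.

(** A path, being continuous on [0, 1] only, is the same as a map on the subtype
[0, 1]: restrict it in one direction, and in the other extend it to the line by
the junk value x outside the interval. *)
Lemma path_componentE :
  path_component R x = ends_at @^-1` (extendable (Z:=endpoints)).
Proof.
have I0 : (0 : R) \in `[0, 1]%classic by rewrite inE /= in_itv /= lexx ler01.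
have I1 : (1 : R) \in `[0, 1]%classic by rewrite inE /= in_itv /= lexx ler01.
pose y0 : unit_interval := SigSub I0; pose y1 : unit_interval := SigSub I1.
have Z0 : y0 \in endpoints by rewrite inE; left.
have Z1 : y1 \in endpoints by rewrite inE; right.
rewrite predeqE => p; split.
  case=> f [cf f0 f1].
  have cg : continuous (sigL `[0, 1]%classic f).
    exact/subspace_sigL_continuousP.
  exists (mkcts cg) => z; rewrite /= /mkcts /curry /endpoint_pair /sigL /=.
  case: ifPn => [/set_mem z0|]; first by rewrite -f0; congr f; exact: z0.
  rewrite notin_setE => z0; rewrite -f1; congr f.
  by case: (set_valP z).
case=> g gE; exists (valL_ x g); split.
- have [_] := @subspace_valL_continuousP' R `[0, 1]%classic X x g.
  by apply=> y; exact: cts_fun.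
- have := congr1 (@^~ y0) (valLK x g); rewrite /sigL /= => ->.
  have -> := gE (SigSub Z0); rewrite /= /mkcts /curry /endpoint_pair /=.
  by rewrite mem_set.
- have := congr1 (@^~ y1) (valLK x g); rewrite /sigL /= => ->.
  have -> := gE (SigSub Z1); rewrite /= /mkcts /curry /endpoint_pair /=.
  by rewrite memNset // => /eqP; rewrite /= oner_eq0.
Qed.

Lemma closed_path_component_of_extendable :
  closed (extendable (Z:=endpoints) : set (continuousType endpoints X)) ->
  closed (path_component R x).
Proof.
rewrite path_componentE.
by move: ends_at_continuous => /continuous_closedP; exact.
Qed.

End EndpointPair.

Theorem proposition2p1 (R : realType) (X : topologicalType)
    (Xspace : compact_metrizable R X)
    (Xpath : exists x : X, ~ closed (path_component R x)) :
  ~ e_closed R X.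
Proof.
move=> Xe; case: Xpath => x; apply; apply: closed_path_component_of_extendable.
exact: Xe compact_metrizable_unit_interval closed_endpoints.
Qed.
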